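(* Let $\Pi$ be the collection of the canonical automorphisms $\pi_R$ of (the underlying racks of) GL-racks, and let $\mathtt{u}$ be the collection of all GL-structures, that is, the collection whose component at a GL-rack $(R,\mathtt{u}_R)$ is $\mathtt{u}_R$. Then: (Z1) The center $Z(\mathsf{GLR})$ of the category of GL-racks is the free abelian group $\langle\Pi,\mathtt{u}\rangle\cong\mathbb{Z}^2$ generated by $\Pi$ and $\mathtt{u}$. (Z2) The centers of the category $\mathsf{GLQ}$ of GL-quandles and of the category of Legendrian racks are each the free group $\langle\mathtt{u}\rangle\cong\mathbb{Z}$. (Z3) The center of the category of Legendrian quandles is the group $\langle\mathtt{u}\mid\mathtt{u}^2=1\rangle\cong\mathbb{Z}/2\mathbb{Z}$.
   Context: For a set $X$, $S_X$ is the group of permutations of $X$; products of maps denote composition. A rack is a pair $(X,s)$ of a set $X$ and a map $s:X\to S_X$, $x\mapsto s_x$, such that $s_xs_y=s_{s_x(y)}s_x$ for all $x,y\in X$; it is a quandle if $s_x(x)=x$ for all $x$. A rack homomorphism $(X,s)\to(Y,t)$ is a map $\varphi:X\to Y$ with $\varphi s_x=t_{\varphi(x)}\varphi$ for all $x\in X$. For a rack $R=(X,s)$, $\pi_R:X\to X$ is the map $x\mapsto s_x(x)$, which is a rack automorphism of $R$. A GL-structure on $R$ is a rack automorphism $\mathtt{u}$ of $R$ such that $\mathtt{u}s_x=s_x\mathtt{u}$ for all $x\in X$; the pair $(R,\mathtt{u})$ is a GL-rack, and a GL-quandle if $R$ is a quandle. A GL-rack homomorphism $(R_1,\mathtt{u}_1)\to(R_2,\mathtt{u}_2)$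 is a rack homomorphism $\varphi$ with $\varphi\mathtt{u}_1=\mathtt{u}_2\varphi$. $\mathsf{GLR}$ is the category of GL-racks and GL-rack homomorphisms, and $\mathsf{GLQ}$ is its full subcategory of GL-quandles. A Legendrian rack is a GL-rack $(R,\mathtt{u})$ with $\pi_R=\mathtt{u}^{-2}$; a Legendrian quandle is a Legendrian rack whose underlying rack is a quandle (equivalently, a GL-quandle with $\mathtt{u}^2=\operatorname{id}$). These form full subcategories of $\mathsf{GLR}$. The center $Z(\mathcal{C})$ of a category $\mathcal{C}$ is the commutative monoid (under composition) of natural endomorphisms of the identity functor $\mathbf{1}_{\mathcal{C}}$. *)

(* Defs.v *)
From HB Require Import structures.
From mathcomp Require Import all_boot all_order all_algebra.
From mathcomp Require Import boolp.

Set Implicit Arguments.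
Unset Strict Implicit.
Unset Printing Implicit Defensive.

Import GRing.Theory.

Local Open Scope group_scope.

(* The group S_X for an arbitrary, possibly infinite, X ({perm T} requires a
   finType). The inverse is stored but is determined by the function, see
   [perm_fun_inj]; the product is composition, (p * q) x = p (q x). *)
Record permutation (X : Type) := Perm {
  perm_fun :> X -> X;
  perm_inv : X -> X;
  perm_funK : cancel perm_fun perm_inv;
  perm_invK : cancel perm_inv perm_fun
}.

Section PermGroup.
Variable X : Type.
Implicit Types p q r : permutation X.

Lemma perm_fun_inj p q : p =1 q -> p = q.
Proof.
case: p q => [f f' fK f'K] [g g' gK g'K] /= /funext fg; subst g.
have e : f' = g' by apply/funext => x; rewrite -[x in RHS]f'K gK.
by subst g'; congr Perm; exact: Prop_irrelevance.
Qed.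

Definition perm_one : permutation X := @Perm X id id (frefl _) (frefl _).

Definition perm_mul p q : permutation X :=
  @Perm X (p \o q) (perm_inv q \o perm_inv p)
    (can_comp (perm_funK p) (perm_funK q))
    (can_comp (perm_invK q) (perm_invK p)).

Definition perm_opp p : permutation X :=
  @Perm X (perm_inv p) p (perm_invK p) (perm_funK p).

Lemma perm_mulA : associative perm_mul.
Proof. by move=> p q r; exact: perm_fun_inj. Qed.

Lemma perm_mul1 : left_id perm_one perm_mul.
Proof. by move=> p; exact: perm_fun_inj. Qed.

Lemma perm_1mul : right_id perm_one perm_mul.
Proof. by move=> p; exact: perm_fun_inj. Qed.

Lemma perm_mulV : left_inverse perm_one perm_opp perm_mul.
Proof. by move=> p; apply: perm_fun_inj => x /=; exact: perm_funK. Qed.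

Lemma perm_Vmul : right_inverse perm_one perm_opp perm_mul.
Proof. by move=> p; apply: perm_fun_inj => x /=; exact: perm_invK. Qed.

HB.instance Definition _ := gen_eqMixin (permutation X).
HB.instance Definition _ := gen_choiceMixin (permutation X).
HB.instance Definition _ := isGroup.Build (permutation X)
  perm_mulA perm_mul1 perm_1mul perm_mulV perm_Vmul.

Lemma permM p q x : (p * q) x = p (q x). Proof. by []. Qed.

End PermGroup.

Record rack := Rack {
  rack_car :> Type;
  rack_op : rack_car -> permutation rack_car;
  rack_ax : forall x y : rack_car,
    rack_op x * rack_op y = rack_op (rack_op x y) * rack_op x
}.

Definition is_quandle (R : rack) : Prop := forall x : R, rack_op x x = x.

Definition is_rack_hom (R S : rack) (phi : R -> S) : Prop :=
  forall x : R, phi \o rack_op x = rack_op (phi x) \o phi.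

Definition rack_pi (R : rack) (x : R) : R := rack_op x x.

Definition is_GL_structure (R : rack) (u : permutation R) : Prop :=
  is_rack_hom u /\ forall x : R, u * rack_op x = rack_op x * u.

Record GLrack := GLRack {
  GL_rack :> rack;
  GL_u : permutation GL_rack;
  GL_ax : is_GL_structure GL_u
}.

Record GLhom (R S : GLrack) := GLHom {
  GLhom_fun :> R -> S;
  GLhom_rack : is_rack_hom GLhom_fun;
  GLhom_u : GLhom_fun \o GL_u R = GL_u S \o GLhom_fun
}.

Definition is_Legendrian (R : GLrack) : Prop :=
  @rack_pi R = GL_u R ^- 2 :> (R -> R).

Definition is_Legendrian_quandle (R : GLrack) : Prop :=
  is_Legendrian R /\ is_quandle R.

Record category := Category {
  obj :> Type;
  hom : obj -> obj -> Type;
  idm : forall A, hom A A;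
  compm : forall A B C, hom B C -> hom A B -> hom A C;
  comp1m : forall A B (f : hom A B), compm (idm B) f = f;
  compm1 : forall A B (f : hom A B), compm f (idm A) = f;
  compmA : forall A B C D (h : hom C D) (g : hom B C) (f : hom A B),
    compm h (compm g f) = compm (compm h g) f
}.
Arguments idm {c} A.

Definition full_subcategory (C : category) (P : C -> Prop) : category :=
  @Category {A : C | P A} (fun A B => hom (sval A) (sval B))
    (fun A => idm (sval A)) (fun A B D g f => compm g f)
    (fun A B f => comp1m f) (fun A B f => compm1 f)
    (fun A B D E h g f => compmA h g f).

Record center (C : category) := Center {
  component :> forall A : C, hom A A;
  naturality : forall (A B : C) (f : hom A B),
    compm f (component A) = compm (component B) f
}.

Section CenterMonoid.
Variable C : category.
Implicit Types a b c : center C.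

Lemma center_ext a b : (forall A : C, a A = b A) -> a = b.
Proof.
case: a b => [a na] [b nb] /= ab.
have e := functional_extensionality_dep ab; subst b.
by congr Center; exact: Prop_irrelevance.
Qed.

Definition center_one : center C :=
  @Center C (fun A => idm A)
    (fun A B f => etrans (compm1 f) (esym (comp1m f))).

Lemma center_mul_nat a b (A B : C) (f : hom A B) :
  compm f (compm (a A) (b A)) = compm (compm (a B) (b B)) f.
Proof. by rewrite compmA (naturality a) -compmA (naturality b) compmA. Qed.

Definition center_mul a b : center C :=
  @Center C (fun A => compm (a A) (b A)) (center_mul_nat a b).

Lemma center_mulA : associative center_mul.
Proof. by move=> a b c; apply: center_ext => A /=; rewrite compmA. Qed.

Lemma center_mul1 : left_id center_one center_mul.
Proof. by move=> a; apply: center_ext => A /=; rewrite comp1m. Qed.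

Lemma center_1mul : right_id center_one center_mul.
Proof. by move=> a; apply: center_ext => A /=; rewrite compm1. Qed.

HB.instance Definition _ := gen_eqMixin (center C).
HB.instance Definition _ := gen_choiceMixin (center C).
HB.instance Definition _ := isMonoid.Build (center C)
  center_mulA center_mul1 center_1mul.

Lemma center_mulC : commutative center_mul.
Proof. by move=> a b; apply: center_ext => A /=; exact: naturality. Qed.

End CenterMonoid.

Definition center_restrict (C : category) (P : C -> Prop) (a : center C) :
    center (full_subcategory P) :=
  @Center (full_subcategory P) (fun A => a (sval A))
    (fun A B f => naturality a f).

Lemma GLhom_ext (R S : GLrack) (f g : GLhom R S) : f =1 g -> f = g.
Proof.
case: f g => [f fr fu] [g gr gu] /= /funext fg; subst g.
by congr GLHom; exact: Prop_irrelevance.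
Qed.

Definition GL_id (R : GLrack) : GLhom R R :=
  @GLHom R R id (fun=> erefl) erefl.

Lemma GL_homE (R S : GLrack) (f : GLhom R S) (x y : R) :
  f (rack_op x y) = rack_op (f x) (f y).
Proof. exact: (congr1 (fun h : R -> S => h y) (GLhom_rack f x)). Qed.

Lemma GL_homuE (R S : GLrack) (f : GLhom R S) (x : R) :
  f (GL_u R x) = GL_u S (f x).
Proof. exact: (congr1 (fun h : R -> S => h x) (GLhom_u f)). Qed.

Lemma GL_comp_rack (R S T : GLrack) (g : GLhom S T) (f : GLhom R S) :
  is_rack_hom (g \o f).
Proof. by move=> x; apply/funext => y /=; rewrite !GL_homE. Qed.

Lemma GL_comp_u (R S T : GLrack) (g : GLhom S T) (f : GLhom R S) :
  (g \o f) \o GL_u R = GL_u T \o (g \o f).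
Proof. by apply/funext => y /=; rewrite !GL_homuE. Qed.

Definition GL_comp (R S T : GLrack) (g : GLhom S T) (f : GLhom R S) :
    GLhom R T := GLHom (GL_comp_rack g f) (GL_comp_u g f).

Lemma GL_comp1m (R S : GLrack) (f : GLhom R S) : GL_comp (GL_id S) f = f.
Proof. exact: GLhom_ext. Qed.

Lemma GL_compm1 (R S : GLrack) (f : GLhom R S) : GL_comp f (GL_id R) = f.
Proof. exact: GLhom_ext. Qed.

Lemma GL_compA (R S T U : GLrack) (h : GLhom T U) (g : GLhom S T)
  (f : GLhom R S) : GL_comp h (GL_comp g f) = GL_comp (GL_comp h g) f.
Proof. exact: GLhom_ext. Qed.

Definition GLR : category := Category GL_comp1m GL_compm1 GL_compA.

Definition GLQ : category :=
  @full_subcategory GLR (fun R : GLrack => is_quandle R).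
Definition LegR : category := @full_subcategory GLR is_Legendrian.
Definition LegQ : category := @full_subcategory GLR is_Legendrian_quandle.

Lemma rack_opE (R : rack) (x y z : R) :
  rack_op x (rack_op y z) = rack_op (rack_op x y) (rack_op x z).
Proof. by rewrite -!permM rack_ax. Qed.

Lemma rack_op_pi (R : rack) (x : R) : rack_op (rack_pi x) = rack_op x.
Proof.
apply: perm_fun_inj => y.
by rewrite -[y](perm_invK (rack_op x)) -rack_opE.
Qed.

Lemma rack_pi_hom (R : rack) : is_rack_hom (@rack_pi R).
Proof.
by move=> x; apply/funext => y /=; rewrite rack_op_pi /rack_pi -rack_opE.
Qed.

Lemma rack_pi_u (R : GLrack) : @rack_pi R \o GL_u R = GL_u R \o @rack_pi R.
Proof.
apply/funext => y /=; rewrite /rack_pi.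
by have [/(_ y)/(congr1 (fun h : R -> R => h y)) /= -> _] := GL_ax R.
Qed.

Definition GL_Pi (R : GLrack) : GLhom R R :=
  GLHom (@rack_pi_hom R) (rack_pi_u R).

Definition GL_U (R : GLrack) : GLhom R R :=
  @GLHom R R (GL_u R) (proj1 (GL_ax R)) erefl.

Lemma Pi_natural (R S : GLrack) (f : GLhom R S) :
  GL_comp f (GL_Pi R) = GL_comp (GL_Pi S) f.
Proof. by apply: GLhom_ext => x /=; rewrite /rack_pi GL_homE. Qed.

Definition Pi_center : center GLR := @Center GLR GL_Pi Pi_natural.

Lemma u_natural (R S : GLrack) (f : GLhom R S) :
  GL_comp f (GL_U R) = GL_comp (GL_U S) f.
Proof. by apply: GLhom_ext => x /=; rewrite GL_homuE. Qed.

Definition u_center : center GLR := @Center GLR GL_U u_natural.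

Definition u_GLQ : center GLQ := center_restrict _ u_center.
Definition u_LegR : center LegR := center_restrict _ u_center.
Definition u_LegQ : center LegQ := center_restrict _ u_center.

(* Isomorphism from an additively written abelian group to a multiplicatively
   written monoid; its existence makes the monoid an abelian group. *)
Definition is_monoid_iso (A : zmodType) (M : monoidType) (f : A -> M) : Prop :=
  [/\ f 0%R = 1, forall x y : A, f (x + y)%R = f x * f y & bijective f].

(* Freeness on given elements, resp. <a | a^2 = 1>, is expressed by an
   isomorphism from Z^2, Z, resp. Z/2Z, carrying the standard generators to
   them. *)
Definition free_abelian_on2 (M : monoidType) (a b : M) : Prop :=
  exists f : (int * int)%type -> M,
    [/\ is_monoid_iso f, f (1, 0)%R = a & f (0, 1)%R = b].

Definition free_on1 (M : monoidType) (a : M) : Prop :=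
  exists2 f : int -> M, is_monoid_iso f & f 1%R = a.

Definition cyclic_of_order2_on (M : monoidType) (a : M) : Prop :=
  exists2 f : 'Z_2 -> M, is_monoid_iso f & f 1%R = a.

(* Main.v *)
Require Import Defs.
From mathcomp Require Import all_boot all_order all_algebra.
From mathcomp Require Import boolp.

(** Let [A] be an abelian group generated by [p] and [v]. The carrier [A] with
    [s_x a = p + a] and [u a = v + a] is a GL-rack, and for a suitable choice of
    [(A, p, v)] it is the free object on [0] in each of the four categories:
    [(Z^2, (1,0), (0,1))] for GL-racks, [(Z, 0, 1)] for GL-quandles,
    [(Z, -2, 1)] for Legendrian racks, [(Z/2, 0, 1)] for Legendrian quandles.
    By naturality a central element is determined by the image of the generator
    under its component at the free object, so the center is [A]. *)

Set Implicit Arguments.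
Unset Strict Implicit.
Unset Printing Implicit Defensive.

Import GRing.Theory.

Local Open Scope group_scope.

(** * Integer powers and generating pairs of abelian groups *)

Lemma int_power_ex (M : monoidType) (a b : M) : a * b = 1 -> b * a = 1 ->
  exists f : int -> M,
    [/\ f 0%R = 1, forall x y : int, f (x + y)%R = f x * f y & f 1%R = a].
Proof.
move=> ab ba.
pose f (m : int) := match m with Posz n => a ^+ n | Negz n => b ^+ n.+1 end.
have fN (n : nat) : f (- n%:Z)%R = b ^+ n by case: n => [|n]; rewrite -?NegzE.
have fS (m : int) : f (1 + m)%R = a * f m.
  case: m => [n|n]; first by rewrite -PoszD add1n /f expgS.
  rewrite NegzE -[n.+1]add1n PoszD opprD addNKr -opprD -PoszD !fN.
  by rewrite expgS mulgA ab mul1g.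
have fP (m : int) : f (-1 + m)%R = b * f m.
  rewrite -[in RHS](addNKr 1%R m) [(1 + _)%R in RHS]addrC addrC fS.
  by rewrite mulgA ba mul1g.
exists f; split=> [|x y|]; [by [] | | exact: expg1].
elim/int_ind: x => [|n IH|n IH]; first by rewrite add0r /= mul1g.
- by rewrite -add1n PoszD -addrA !fS IH mulgA.
- by rewrite -add1n PoszD opprD -addrA !fP IH mulgA.
Qed.

(** Serves to iterate a translation over all integers; in the negative direction the recurrence is
    inverted by cancelling [v]. *)
Lemma int_shift (A : zmodType) (g : int -> A) (v : A) :
  (forall n, g (1 + n)%R = (v + g n)%R) -> forall n, g n = (v *~ n + g 0)%R.
Proof.
move=> gS; have vS k : (v *~ (1 + k) = v + v *~ k)%R by rewrite mulrzDr.
elim/int_ind => [|n IH|n IH]; first by rewrite mulr0z add0r.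
- by rewrite -add1n PoszD gS IH vS addrA.
- apply: (@addrI _ v); rewrite -gS addrA -vS.
  by have -> : (1 - n.+1%:Z = - n%:Z)%R by rewrite -add1n PoszD opprD addNKr.
Qed.

Definition generates2 (A : zmodType) (p v : A) : Prop :=
  forall a : A, exists m n : int, a = (p *~ m + v *~ n)%R.

Lemma int_generates2 (p : int) : generates2 p 1%R.
Proof. by move=> a; exists 0%R, a; rewrite mulr0z add0r intz. Qed.

Lemma int2_generates2 : generates2 ((1, 0) : int * int)%R (0, 1)%R.
Proof.
move=> [m n]; exists m, n.
have pairMz (x y k : int) : ((x, y) *~ k = (x *~ k, y *~ k))%R.
  rewrite [LHS]surjective_pairing; congr pair; first exact: (raddfMz fst).
  exact: (raddfMz snd).
by rewrite !pairMz !mul0rz !intz /=; congr pair; rewrite /= ?addr0 ?add0r.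
Qed.

Lemma Z2_generates2 (p : 'Z_2) : generates2 p 1%R.
Proof.
move=> a; exists 0%R, (Posz a).
by rewrite mulr0z add0r -pmulrn natr_Zp.
Qed.

(** * Translation racks *)

(* The carrier is a type [X] in bijection with [A] rather than [A] itself: racks
   live in a universe strictly below that of the sorts of [zmodType], since the
   centers are themselves carriers of algebraic structures. *)
Section TranslationRack.
Variables (X : Type) (A : zmodType) (c : X -> A) (d : A -> X).
Hypotheses (cK : cancel c d) (dK : cancel d c).
Variables (p v : A).

Definition translate (a : A) (x : X) : X := d (a + c x)%R.

Lemma translateK a : cancel (translate a) (translate (- a)%R).
Proof. by move=> x; rewrite /translate dK addKr cK. Qed.

Lemma translateVK a : cancel (translate (- a)%R) (translate a).
Proof. by move=> x; rewrite /translate dK addNKr cK. Qed.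

Definition translation (a : A) : permutation X :=
  Perm (translateK a) (translateVK a).

Lemma translateC a b x :
  translate a (translate b x) = translate b (translate a x).
Proof. by rewrite /translate !dK addrCA. Qed.

Lemma translation_rack_ax (x y : X) :
  translation p * translation p = translation p * translation p.
Proof. by []. Qed.

Definition translation_rack : rack :=
  @Rack X (fun=> translation p) translation_rack_ax.

Lemma translation_GL_ax : @is_GL_structure translation_rack (translation v).
Proof.
split=> x; first by apply/funext => y; exact: translateC.
by apply: perm_fun_inj => y; exact: translateC.
Qed.

Definition translation_GLrack : GLrack := GLRack translation_GL_ax.

End TranslationRack.

(** * Rack operators as endomorphisms, and pointwise naturality *)

Section OperatorHom.
Variables (R : GLrack) (x : R).

Lemma rack_op_hom : is_rack_hom (rack_op x).
Proof. by move=> y; apply/funext => z /=; rewrite rack_opE. Qed.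

Lemma rack_op_u : rack_op x \o GL_u R = GL_u R \o rack_op x.
Proof.
apply/funext => y; have [_ /(_ x)] := GL_ax R.
by move=> /(congr1 (fun q : permutation R => q y)) /= ->.
Qed.

(** Naturality along this endomorphism makes every central element commute with [s_x]. *)
Definition GL_op : GLhom R R := GLHom rack_op_hom rack_op_u.

End OperatorHom.

Lemma centerE (P : GLrack -> Prop) (z : center (@full_subcategory GLR P))
    (R S : @full_subcategory GLR P) (h : GLhom (sval R) (sval S)) x :
  h (z R x) = z S (h x).
Proof. exact: (congr1 (fun k : GLhom _ _ => k x) (@naturality _ z R S h)). Qed.

(** * The center of a full subcategory containing a translation rack *)

Section CenterIso.
Variables (X : Type) (A : zmodType) (c : X -> A) (d : A -> X).
Hypotheses (cK : cancel c d) (dK : cancel d c).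
Variables (P : GLrack -> Prop) (p v : A).
Local Notation C := (@full_subcategory GLR P).
Variable f : A -> center C.
Hypothesis f0 : f 0%R = 1.
Hypothesis fD : forall a b, f (a + b)%R = f a * f b.
Hypothesis fp : forall (R : C) x, f p R x = @rack_pi (sval R) x.
Hypothesis fv : forall (R : C) x, f v R x = GL_u (sval R) x.
Hypothesis gen : generates2 p v.
Local Notation F0 := (translation_GLrack cK dK p v).
Hypothesis PF : P F0.

Let F : C := exist P F0 PF.
Let origin : X := d 0%R.

Lemma center_famD a b (R : C) x : f (a + b)%R R x = f a R (f b R x).
Proof. by rewrite fD. Qed.

Lemma center_fam_opC a (R : C) (y x : sval R) :
  f a R (rack_op y x) = rack_op y (f a R x).
Proof. by rewrite -(centerE (f a) (GL_op y)). Qed.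

(* [f a] is an automorphism commuting with every [s_y], hence
   [s_(f a y) = f a \o s_y \o f (- a) = s_y]. *)
Lemma center_fam_op a (R : C) (y : sval R) : rack_op (f a R y) = rack_op y.
Proof.
apply: perm_fun_inj => x.
have -> : x = f a R (f (- a)%R R x) by rewrite -center_famD subrr f0.
by rewrite -GL_homE center_fam_opC.
Qed.

Section Orbit.
Variables (R : C) (x : sval R).

Definition orbit_fun (a : F0) : sval R := f (c a) R x.

(** Since [f (c a) R x] has the same operator as [x], both sides reduce to [f (c b)] applied to
    [s_x x], which is [f p R x]. *)
Lemma orbit_rack_hom : is_rack_hom orbit_fun.
Proof.
move=> a; apply/funext => b.
rewrite /= /orbit_fun center_fam_op -center_fam_opC /translate dK addrC.
by rewrite center_famD fp.
Qed.

Lemma orbit_u : orbit_fun \o GL_u F0 = GL_u (sval R) \o orbit_fun.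
Proof.
by apply/funext => a; rewrite /= /orbit_fun /translate dK center_famD fv.
Qed.

(** The morphism given by the universal property of [F]: it sends the origin to [x]. *)
Definition orbit_hom : @Defs.hom C F R := GLHom orbit_rack_hom orbit_u.

Lemma orbit_hom0 : orbit_hom origin = x.
Proof. by rewrite /= /orbit_fun dK f0. Qed.

End Orbit.

(** On [F] the components of [f p] and [f v] are the translations by [p] and [v]; iterating them
    reaches every [a] because [p] and [v] generate [A]. *)
Lemma center_fam_translation (a : A) : f a F origin = d a.
Proof.
have [m [n ->]] := gen a; rewrite center_famD.
have gen_shift w (x : X) k : (forall y : X, f w F y = translate c d w y) ->
    c (f (w *~ k)%R F x) = (w *~ k + c x)%R.
  move=> fw; rewrite (@int_shift A (fun k => c (f (w *~ k)%R F x)) w).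
    by rewrite mulr0z f0.
  by move=> i; rewrite mulrzDr mulr1z center_famD fw dK.
apply: (can_inj cK); rewrite dK gen_shift => [|y]; last by rewrite fp.
by rewrite gen_shift => [|y]; [rewrite dK addr0 | rewrite fv].
Qed.

Lemma center_at_orbit (z : center C) (R : C) (x : sval R) :
  z R x = orbit_hom x (z F origin).
Proof. by rewrite (@centerE P z F R (orbit_hom x)) orbit_hom0. Qed.

Lemma center_iso : is_monoid_iso f.
Proof.
(* The inverse evaluates a central element at the origin; agreement there spreads to all [R] and [x]
   along [orbit_hom]. *)
split=> //; exists (fun z : center C => c (z F origin)) => [a|z].
  by rewrite center_fam_translation dK.
apply: center_ext => R; apply: GLhom_ext => x.
by rewrite (center_at_orbit (f _)) center_fam_translation cK -center_at_orbit.
Qed.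

End CenterIso.

(** * Invertibility of [Pi_center] and [u_center] *)

Lemma GLhom_inverse (R S : GLrack) (h : GLhom R S) (g : S -> R) :
  cancel h g -> cancel g h ->
  is_rack_hom g /\ g \o GL_u S = GL_u R \o g.
Proof.
move=> hK gK; split=> [x|]; apply/funext => y /=.
  by rewrite -[x in LHS]gK -[y in LHS]gK -GL_homE hK.
by rewrite -[y in LHS]gK -GL_homuE hK.
Qed.

(** Pointwise inverses suffice: the inverse of a bijective morphism is a morphism, and naturality of
    [z] passes to the inverses. *)
Lemma center_GLR_inverse (z : center GLR) (g : forall R : GLrack, R -> R) :
  (forall R, cancel (z R) (g R)) -> (forall R, cancel (g R) (z R)) ->
  exists w, z * w = 1 /\ w * z = 1.
Proof.
move=> zK gK.
pose h (R : GLR) : Defs.hom R R :=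
  let: conj gr gu := GLhom_inverse (zK R) (gK R) in GLHom gr gu.
have hE (R : GLR) : h R =1 g R by rewrite /h; case: GLhom_inverse.
have h_nat (R S : GLR) (k : Defs.hom R S) : compm k (h R) = compm (h S) k.
  apply: GLhom_ext => x /=; rewrite !hE -[x in RHS]gK.
  have := naturality z k => /(congr1 (fun l : GLhom _ _ => l (g R x))) /= ->.
  by rewrite zK.
exists (Center h_nat); split; apply: center_ext => R; apply: GLhom_ext => x /=.
  by rewrite hE gK.
by rewrite hE zK.
Qed.

Lemma rack_piK (R : rack) :
  cancel (@rack_pi R) (fun x => perm_inv (rack_op x) x).
Proof. by move=> x; rewrite rack_op_pi perm_funK. Qed.

Lemma rack_piVK (R : rack) :
  cancel (fun x => perm_inv (rack_op x) x) (@rack_pi R).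
Proof.
(* With [y] the preimage of [x] under [s_x], self-distributivity turns [s_x (s_y y)] into
   [s_x x]. *)
move=> x; rewrite /rack_pi; apply: (can_inj (perm_funK (rack_op x))).
by rewrite rack_opE !perm_invK.
Qed.

Lemma Pi_power_ex : exists f : int -> center GLR,
  [/\ f 0%R = 1, forall x y : int, f (x + y)%R = f x * f y
    & f 1%R = Pi_center].
Proof.
have [w [zw wz]] := @center_GLR_inverse Pi_center _ rack_piK rack_piVK.
exact: int_power_ex zw wz.
Qed.

Lemma u_power_ex : exists f : int -> center GLR,
  [/\ f 0%R = 1, forall x y : int, f (x + y)%R = f x * f y
    & f 1%R = u_center].
Proof.
have [w [zw wz]] := @center_GLR_inverse u_center _
  (fun R => perm_funK (GL_u R)) (fun R => perm_invK (GL_u R)).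
exact: int_power_ex zw wz.
Qed.

(** * Computation of the four centers *)

Lemma center_restrict1 (C : category) (P : C -> Prop) :
  center_restrict P 1 = 1.
Proof. exact: center_ext. Qed.

Lemma center_restrictM (C : category) (P : C -> Prop) (a b : center C) :
  center_restrict P (a * b) = center_restrict P a * center_restrict P b.
Proof. exact: center_ext. Qed.

Lemma center_GLR_free : free_abelian_on2 Pi_center u_center.
Proof.
have [f [f0 fD f1]] := Pi_power_ex; have [g [g0 gD g1]] := u_power_ex.
pose k (a : (int * int)%type) : center GLR := f a.1 * g a.2.
have k0 : k 0%R = 1 by rewrite /k f0 g0 mulg1.
have kD a b : k (a + b)%R = k a * k b.
  have fgC : g a.2 * f b.1 = f b.1 * g a.2 := center_mulC (g a.2) (f b.1).
  by rewrite /k fD gD !mulgA; congr (_ * _); rewrite -!mulgA fgC.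
have k1 : k (1, 0)%R = Pi_center by rewrite /k f1 g0 mulg1.
have k2 : k (0, 1)%R = u_center by rewrite /k f0 g1 mul1g.
exists k; split=> //; split=> //.
(* [center_iso] concerns full subcategories, so it is applied to the one on all objects; injectivity
   of restriction carries the bijection back. *)
pose P : GLR -> Prop := fun=> True.
have res_inj : injective (@center_restrict GLR P).
  move=> a b ab; apply: center_ext => R.
  exact: (congr1 (fun c : center (full_subcategory P) => c (exist P R I)) ab).
have [] // := @center_iso (int * int)%type _ id id (frefl id) (frefl id)
  P (1, 0)%R (0, 1)%R (fun a => center_restrict P (k a)).
- by rewrite k0 center_restrict1.
- by move=> a b; rewrite kD center_restrictM.
- by move=> R x; rewrite k1.
- by move=> R x; rewrite k2.
- exact: int2_generates2.
move=> _ _ [h hK Kh]; exists (h \o center_restrict P) => [a|z] /=.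
  exact: hK.
by apply: res_inj; rewrite Kh.
Qed.

(** Treats GL-quandles ([k = 0]) and Legendrian racks ([k = 2]) together: as [Pi] is [u ^- k], it
    corresponds to [-k] when [u] corresponds to [1]. *)
Lemma center_sub_free (P : GLrack -> Prop) (k : nat) :
  (forall R : GLrack, P R -> @rack_pi R =1 GL_u R ^- k) ->
  P (translation_GLrack (frefl (@id int)) (frefl id) (- k%:Z)%R 1%R) ->
  free_on1 (center_restrict (C := GLR) P u_center).
Proof.
move=> piE PF; have [f [f0 fD f1]] := u_power_ex.
exists (fun a => center_restrict (C := GLR) P (f a)); last by rewrite f1.
apply: (center_iso _ _ _ _ (@int_generates2 _) PF).
- by rewrite f0 center_restrict1.
- by move=> a b; rewrite fD center_restrictM.
- move=> [R PR] x; rewrite (piE R PR) /=.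
  have fk n y : f (Posz n) R y = (GL_u R ^+ n) y.
    elim: n => [|n IH]; first by rewrite f0.
    by rewrite -add1n PoszD fD f1 /= IH expgS.
  (* The value of [f (- k)] is found by applying [u ^+ k], the component of [f k]. *)
  apply: (can_inj (perm_funK (GL_u R ^+ k))); rewrite -fk perm_invK.
  have := fD (Posz k) (- k%:Z)%R; rewrite subrr f0.
  by move=> /(congr1 (fun z : center GLR => z R x)) /= <-.
- by move=> R x; rewrite f1.
Qed.

Lemma center_GLQ_free : free_on1 u_GLQ.
Proof.
apply: (@center_sub_free _ 0) => [R qR x|x]; first exact: qR.
by rewrite /= /translate oppr0 add0r.
Qed.

Lemma center_LegR_free : free_on1 u_LegR.
Proof.
apply: (@center_sub_free _ 2) => [R LR x|]; first by rewrite LR.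
by apply/funext => x; rewrite /rack_pi /= /translate addrA.
Qed.

Lemma center_LegQ_cyclic : cyclic_of_order2_on u_LegQ.
Proof.
have u2 : u_LegQ * u_LegQ = 1.
  apply: center_ext => -[R [LR qR]]; apply: GLhom_ext => x /=.
  (* Here [rack_pi] is both the identity and [u ^- 2]. *)
  rewrite -[x in LHS]qR -/(rack_pi x) LR.
  by rewrite -[LHS]/((GL_u R ^+ 2) ((GL_u R ^- 2) x)) perm_invK.
(* Addition in ['Z_2] reduces modulo 2, so additivity needs powers that depend only on parity. *)
have uX n : u_LegQ ^+ (n %% 2) = u_LegQ ^+ n.
  by rewrite [in RHS](divn_eq n 2) expgnDr mulnC expgnA expg2 u2 expg1n mul1g.
exists (fun a : 'Z_2 => u_LegQ ^+ a); last exact: expg1.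
(* The free object is carried by [bool], identified with ['Z_2] by parity. *)
pose c (b : bool) : 'Z_2 := inZp b; pose d (a : 'Z_2) : bool := odd a.
have cK : cancel c d by case.
have dK : cancel d c by move=> a; apply/val_inj; case: a => [[|[|]]].
have Leg : is_Legendrian_quandle (translation_GLrack cK dK 0%R 1%R).
  by split; [apply/funext => /= -[] | move=> /= -[]].
apply: (center_iso _ _ _ _ (@Z2_generates2 0%R) Leg) => //.
- by move=> a b; rewrite -expgnDr -[RHS]uX.
- by move=> [R [LR qR]] x; rewrite expg0 /=; apply/esym; exact: qR.
Qed.

Theorem theorem5p1 :
  [/\ free_abelian_on2 Pi_center u_center,
      free_on1 u_GLQ /\ free_on1 u_LegR
    & cyclic_of_order2_on u_LegQ].
Proof.
split; [exact: center_GLR_free | | exact: center_LegQ_cyclic].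
by split; [exact: center_GLQ_free | exact: center_LegR_free].
Qed.
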